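(* Let $G$ be a finite group, let $G=AB$ be the product of the subgroups $A$ and $B$, and suppose that $G=AB$ is a Baer factorisation. Let $x\in X$ be an element of prime power order, where $X\in\{A,B\}$. If $i_G(x)$ is a $q$-number for some prime $q$, then $i_X(x)$ is also a $q$-number. In particular, $A$ and $B$ are Baer groups.
   Context: All groups are finite. For a group $H$ and $x\in H$, the index of $x$ in $H$ is $i_H(x)=|H:C_H(x)|$. The number $1$ is regarded as a power of every prime; a $q$-number is a power of $q$ (possibly $1$). ''$G=AB$ is the product of the subgroups $A$ and $B$'' means that $G=\{ab : a\in A, b\in B\}$. $G=AB$ is a Baer factorisation if $i_G(x)$ is a prime power for every element $x\in A\cup B$ of prime power order. A group $H$ is a Baer group if $i_H(x)$ is a prime power for every element $x\in H$ of prime power order. *)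

(* Defs.v *)
From HB Require Import structures.
From mathcomp Require Import all_boot all_fingroup all_solvable.

Set Implicit Arguments.
Unset Strict Implicit.
Unset Printing Implicit Defensive.

Local Open Scope group_scope.

(* For p prime, [p.-nat n] says that n is a power of p, possibly 1; hence 1 is
   a prime power. *)
Definition prime_power (n : nat) : Prop := exists2 p : nat, prime p & p.-nat n.

Definition elt_index (gT : finGroupType) (H : {group gT}) (x : gT) : nat :=
  #|H : 'C_H[x]|.

Definition Baer_group (gT : finGroupType) (H : {group gT}) : Prop :=
  forall x : gT, x \in H -> prime_power #[x] -> prime_power (elt_index H x).

(* [A * B] is the set of all products a * b with a \in A and b \in B. *)
Definition Baer_factorisation (gT : finGroupType) (G A B : {group gT}) : Prop :=
  A * B = G /\
  forall x : gT, x \in A :|: B -> prime_power #[x] -> prime_power (elt_index G x).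

(* Main.v *)
(** The engine is [coprime_class_cent]: if |x^G| and |y^G| are coprime, y is an
    r-element and r does not divide |x^G|, then some conjugate of x commutes
    with y, and G = C_G(x) C_G(y) makes all of them do so.

    A group with a Baer factorisation is solvable: in a minimal counterexample
    no two nontrivial elements have commuting classes, so if w is an r-element
    of A \cup B whose class size is a power of s, every other element of prime
    power order in A \cup B is an r- or an s-element, and Burnside's
    p^a q^b theorem applies.

    Let x \in A be a p-element whose class size is a power of q.
    If p <> q, then modulo O_q(G) the element x lies in O_p(G) by solvability,
    hence commutes with all q'-elements of A of prime power order, and a
    Frattini argument lifts this to A.
    If p = q, then x lies in N = O_q(G), and a Sylow q-subgroup of A, or of B,
    either lies in N or centralises N.  The only nontrivial case is that N is
    a Sylow subgroup of G; then, for z an r-element with r <> q, the conjugates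
    of C_N(z) Z(N) cover generators of N, so N = C_N(z) Z(N), and the elements
    of N conjugate into C_N(z) already lie in it. *)
Require Import Defs.
From mathcomp Require Import all_boot all_fingroup all_solvable all_character.

Local Open Scope group_scope.

(** * Class sizes and Sylow subgroups in arbitrary finite groups *)

Section ClassSizes.

Set Implicit Arguments.
Unset Strict Implicit.

Variable gT : finGroupType.
Implicit Types (A B G H K X R P : {group gT}) (x y z g : gT) (p q r : nat).

(** For a prime [r] other than [q], [H] contains a Sylow [r]-subgroup of [X], so [r] does not divide
    the index. *)
Lemma index_pnat_of_elts q X H :
    H \subset X ->
    (forall r z, prime r -> r != q -> z \in X -> r.-elt z -> z \in H) ->
  q.-nat #|X : H|.
Proof.
move=> sHX eltH; apply/pnatP=> // r r_pr; apply: contraLR; rewrite inE => neq_rq.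
have [R sylR] := Sylow_exists r X; have [sRX rR r'R] := and3P sylR.
have sRH: R \subset H.
  by apply/subsetP=> z Rz; apply: eltH neq_rq _ _; rewrite ?(subsetP sRX) ?(mem_p_elt rR).
by rewrite -p'natE // (pnat_dvd (indexgS X sRH)).
Qed.

Lemma pnat_indexM (pi : nat_pred) G H K :
  H * K = G -> pi.-group K -> pi.-nat #|G : H|.
Proof. by move=> <- piK; rewrite indexMg (pnat_dvd (dvdn_indexg K H)). Qed.

Lemma Sylow_sub_cent1 r G x :
  r^'.-nat #|x ^: G| -> exists2 R : {group gT}, r.-Sylow(G) R & R \subset 'C[x].
Proof.
rewrite -index_cent1 => r'x; have [R sylR] := Sylow_exists r 'C_G[x].
exists R; last by rewrite (subset_trans (pHall_sub sylR)) ?subsetIr.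
have sRC := pHall_sub sylR; have sCG: 'C_G[x] \subset G by apply: subsetIl.
rewrite pHallE (subset_trans sRC) //= -(Lagrange sCG) partnM //.
by rewrite (part_p'nat r'x) muln1 (card_Hall sylR).
Qed.

Lemma classJ_cent1M G (H : {set gT}) x g :
  'C_G[x] * H = G -> g \in G -> exists2 h, h \in H & x ^ g = x ^ h.
Proof.
move=> defG; rewrite -defG => /mulsgP[c h /setIP[_ /cent1P cxc] Hh ->].
by exists h; rewrite // conjgM {2}/conjg -cxc mulKg.
Qed.

Lemma conj_cent1_elt r G x y :
    r^'.-nat #|x ^: G| -> y \in G -> r.-elt y ->
  exists2 g, g \in G & y \in 'C[x ^ g].
Proof.
move=> r'x Gy ry; have [R sylR cRx] := Sylow_sub_cent1 r'x.
have syG: <[y]> \subset G by rewrite cycle_subG.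
have [g Gg sygR] := Sylow_Jsub sylR syG ry.
exists g^-1; rewrite ?groupV // cent1J mem_conjgV.
by rewrite (subsetP cRx) // (subsetP sygR) // memJ_conjg cycle_id.
Qed.

Lemma coprime_class_cent r G x y :
    r^'.-nat #|x ^: G| -> coprime #|x ^: G| #|y ^: G| -> y \in G -> r.-elt y ->
  y \in 'C(x ^: G).
Proof.
move=> r'x; rewrite -!index_cent1 => co_xy Gy ry.
have defG: 'C_G[x] * 'C_G[y] = G by apply: coprime_index_mulG => //; rewrite subsetIl.
have key h: h \in G -> (y \in 'C[x ^ h]) = (y \in 'C[x]).
  case/(classJ_cent1M defG) => c /setIP[_ /cent1P cyc] ->.
  by rewrite cent1J mem_conjg conjgE invgK mulgA cyc mulgK.
have [g Gg] := conj_cent1_elt r'x Gy ry; rewrite key // => cyx.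
by apply/centP=> _ /imsetP[h Gh ->]; apply/cent1P; rewrite key.
Qed.

Lemma cent_pcore_class p G x : p^'.-nat #|x ^: G| -> x \in 'C('O_p(G)).
Proof.
move=> p'x; have [P sylP cPx] := Sylow_sub_cent1 p'x.
by rewrite -sub_cent1 (subset_trans _ cPx) // pcore_sub_Hall.
Qed.

Lemma Sylow_cent1M p G P x :
  p.-Sylow(G) P -> p.-nat #|x ^: G| -> 'C_G[x] * P = G.
Proof.
move=> sylP px; have [sPG _ p'P] := and3P sylP.
by apply: coprime_index_mulG; rewrite ?subsetIl // index_cent1 (pnat_coprime px).
Qed.

(** As [G = C_G(x) P] for a Sylow [p]-subgroup [P] containing [x], all conjugates of [x] are
    [P]-conjugates, so the normal closure of [x] lies in [P]. *)
Lemma mem_pcore_class p G x :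
  x \in G -> p.-elt x -> p.-nat #|x ^: G| -> x \in 'O_p(G).
Proof.
move=> Gx p_x px.
have sxG: <[x]> \subset G by rewrite cycle_subG.
have [P sylP sxP] := Sylow_superset sxG p_x.
rewrite cycle_subG in sxP.
have sxGP: <<x ^: G>> \subset P.
  rewrite gen_subG; apply/subsetP=> _ /imsetP[g Gg ->].
  have [h Ph ->] := classJ_cent1M (Sylow_cent1M sylP px) Gg.
  by rewrite groupJ.
have sxO: <<x ^: G>> \subset 'O_p(G).
  rewrite pcore_max ?(pgroupS sxGP) ?(pHall_pgroup sylP) //.
  by rewrite /normal gen_subG class_subG // norms_gen ?class_norm.
by rewrite (subsetP sxO) // mem_gen ?class_refl.
Qed.

Lemma Sylow_mulG p G A B :
    A * B = G ->
  exists P Q S : {group gT},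
    [/\ p.-Sylow(A) P, p.-Sylow(B) Q, p.-Sylow(G) S & P * Q = S].
Proof.
move=> defG; have [P0 sylP0] := Sylow_exists p A.
have [Q0 sylQ0] := Sylow_exists p B.
have sAG: A \subset G by rewrite -defG mulG_subl.
have sBG: B \subset G by rewrite -defG mulG_subr.
have [S0 sylS0 sPS0] := Sylow_superset (subset_trans (pHall_sub sylP0) sAG) (pHall_pgroup sylP0).
have [g Gg sQS0] := Sylow_subJ sylS0 (subset_trans (pHall_sub sylQ0) sBG) (pHall_pgroup sylQ0).
have [a [b [Aa Bb defg]]]: exists a b, [/\ a \in A, b \in B & g = a * b].
  by move: Gg; rewrite -defG => /mulsgP[a b Aa Bb ->]; exists a, b.
(* Writing [g = a * b] puts both conjugates inside [S0 :^ a]. Equality follows by counting, as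
   [#|P :&: Q|] is at most the [p]-part of [#|A :&: B|]. *)
pose P := (P0 :^ a)%G; pose Q := (Q0 :^ b^-1)%G; pose S := (S0 :^ a)%G.
have sylP: p.-Sylow(A) P by rewrite pHallJ.
have sylQ: p.-Sylow(B) Q by rewrite pHallJ ?groupV.
have sylS: p.-Sylow(G) S by rewrite pHallJ ?(subsetP sAG).
exists P, Q, S; split=> //; apply/eqP; rewrite eqEcard mul_subG /=; first last.
- by rewrite sub_conjgV -conjsgM -defg.
- by rewrite conjSg.
have pPQ: p.-group (P :&: Q) by apply: pgroupS (subsetIl P Q) (pHall_pgroup sylP).
rewrite -(leq_pmul2r (cardG_gt0 (P :&: Q))) -mul_cardG.
rewrite (card_Hall sylS) (card_Hall sylP) (card_Hall sylQ) -partnM // mul_cardG.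
rewrite defG partnM // leq_pmul2l // -(part_pnat_id pPQ).
by rewrite dvdn_leq ?partn_dvd // cardSg ?setISS ?(pHall_sub sylP) ?(pHall_sub sylQ).
Qed.

Lemma solvable_cent_Fitting G : solvable G -> 'C_G('F(G)) \subset 'F(G).
Proof.
move=> solG; set C := 'C_G('F(G)).
have nsCG: C <| G.
  by rewrite /normal subsetIl normsI ?normG // norms_cent ?gFnorm.
have [n Cn1] := derivedP _ (solvableS (normal_sub nsCG) solG).
have: C^`(n) \subset 'F(G) by rewrite Cn1 sub1G.
elim: n {Cn1} => [|n IHn] sF; first by rewrite derg0 in sF.
(* The derived subgroup of [C^`(n)] lies in the Fitting subgroup, which [C]
   centralises, so [C^`(n)] has nilpotency class at most 2. *)
apply: IHn; apply: Fitting_max; first exact: gFnormal_trans.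
apply/lcnP; exists 2; rewrite !lcnSn lcn1 -dergSn; apply/commG1P.
rewrite (subset_trans sF) // centsC (subset_trans (der_sub n C)) //.
exact: subsetIr.
Qed.

End ClassSizes.

(** * Quotients and solvability of Baer factorisations *)

Section BaerFactorisations.

Set Implicit Arguments.
Unset Strict Implicit.

Implicit Types gT : finGroupType.

Lemma Baer_class gT (G A B : {group gT}) p x :
    Baer_factorisation G A B -> x \in A :|: B -> prime p -> p.-elt x ->
  exists2 s, prime s & s.-nat #|x ^: G|.
Proof.
case=> _ baerG ABx p_pr p_x; rewrite -index_cent1.
by apply: baerG => //; exists p.
Qed.

Lemma Baer_factorisationC gT (G A B : {group gT}) :
  Baer_factorisation G A B -> Baer_factorisation G B A.
Proof.
case=> defG baerG; split=> [|x]; last by rewrite setUC; apply: baerG.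
by rewrite -(comm_group_setP _) // defG groupP.
Qed.

Lemma dvdn_class_quotient gT (G N : {group gT}) x :
  N <| G -> #|coset N x ^: (G / N)| %| #|x ^: G|.
Proof.
case/andP=> _ nNG; rewrite -!index_cent1.
apply: dvdn_trans (index_quotient (G := G) (K := 'C_G[x]) (H := N) _); last first.
  by rewrite subIset ?nNG.
by rewrite indexgS // quotient_subcent1.
Qed.

(** An element of [p]-power order in a factor of the quotient lifts to one in the same factor of
    [G]: the [p]-part of any preimage there. *)
Lemma Baer_quotient gT (G A B N : {group gT}) :
    N <| G -> Baer_factorisation G A B ->
  Baer_factorisation (G / N) (A / N) (B / N).
Proof.
move=> nsNG baerG; have [defG _] := baerG; have [sNG nNG] := andP nsNG.
have nNA: A \subset 'N(N) by rewrite (subset_trans _ nNG) // -defG mulG_subl.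
split=> [|x ABx [p p_pr p_x]]; first by rewrite -quotientMl // defG.
have [y ABy defx]: exists2 y, y \in A :|: B & x = coset N y.
  by case/setUP: ABx => /morphimP[y _ Xy ->]; exists y; rewrite // inE Xy ?orbT.
have nNy: y \in 'N(N).
  apply: (subsetP nNG); rewrite -defG; case/setUP: ABy => [Ay | By].
    by rewrite -[y]mulg1 mem_mulg.
  by rewrite -[y]mul1g mem_mulg.
have {}defx: x = coset N y.`_p by rewrite morph_constt //= -defx constt_p_elt.
have ABz: y.`_p \in A :|: B.
  by case/setUP: ABy => Xy; apply/setUP; [left | right]; apply: groupX.
have [s s_pr sy] := Baer_class baerG ABz p_pr (p_elt_constt p y).
exists s => //; rewrite /elt_index index_cent1 defx.
exact: pnat_dvd (dvdn_class_quotient _ nsNG) sy.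
Qed.

Lemma Baer_solvable gT (G A B : {group gT}) :
  Baer_factorisation G A B -> solvable G.
Proof.
have [n] := ubnP #|G|; elim: n => // n IHn in gT G A B *.
rewrite ltnS => leGn baerG; have [defG _] := baerG.
apply: contraT => nsolG.
have sABG x: x \in A :|: B -> x \in G.
  rewrite -defG; case/setUP=> Xx; first by rewrite -[x]mulg1 mem_mulg.
  by rewrite -[x]mul1g mem_mulg.
have solQ (N : {group gT}): N <| G -> N :!=: 1 -> solvable (G / N).
  move=> nsNG ntN; apply: IHn (Baer_quotient nsNG baerG).
  by rewrite (leq_trans _ leGn) // ltn_quotient ?normal_sub.
have nosol (N : {group gT}): N <| G -> solvable N -> N :=: 1.
  move=> nsNG solN; apply/eqP/idPn => ntN.
  by case/negP: nsolG; rewrite (series_sol nsNG) solN solQ.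
(* If [y] centralises the normal closure [M] of [x], then [C] is nontrivial, [M :&: C] is abelian
   and [M / (M :&: C)] embeds in the solvable group [G / C]. So [M] is solvable, hence trivial. *)
have nocent x y: x \in G -> y \in G -> x != 1 -> y != 1 -> y \notin 'C(x ^: G).
  move=> Gx Gy ntx nty; apply: contra ntx => cxy.
  pose M := <<x ^: G>>%G; pose C := 'C_G(M)%G.
  have nsMG: M <| G by rewrite /normal gen_subG class_subG // norms_gen ?class_norm.
  have nsCG: C <| G.
    by rewrite /normal subsetIl normsI ?normG // norms_cent ?normal_norm.
  have ntC: C :!=: 1.
    by apply/trivgPn; exists y; rewrite // inE Gy /= cent_gen.
  have solM: solvable M.
    have nsCM: C :&: M <| M.
      rewrite setIC; exact: normalGI (normal_sub nsMG) nsCG.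
    rewrite (series_sol nsCM) abelian_sol /=.
      have nCM: M \subset 'N(C) by rewrite (subset_trans (normal_sub nsMG)) ?normal_norm.
      rewrite (isog_sol (second_isog nCM)).
      by rewrite (solvableS _ (solQ C nsCG ntC)) // quotientS ?normal_sub.
    by rewrite /abelian subIset // subIset // centS ?orbT // subsetIr.
  by rewrite -in_set1 -[[set 1]](nosol M nsMG solM) mem_gen ?class_refl.
have typeP r w: prime r -> w \in A :|: B -> r.-elt w -> w != 1 ->
    exists s, [/\ prime s, s != r & s.-nat #|w ^: G|].
  move=> r_pr ABw r_w ntw.
  have [s s_pr sw] := Baer_class baerG ABw r_pr r_w.
  exists s; split=> //; apply: contraNneq ntw => eq_sr; rewrite eq_sr in sw.
  rewrite -in_set1 -[[set 1]](nosol 'O_r(G)%G (pcore_normal r G)).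
    exact: mem_pcore_class (sABG w ABw) r_w sw.
  exact: pgroup_sol (pcore_pgroup r G).
(* Since [half] applies to [(w, w')] and to [(w', w)], two elements with
   different class primes swap their element and class primes. *)
have half s r' s' w w' : prime s -> prime s' -> prime r' ->
    w \in G -> w' \in G -> w != 1 -> w' != 1 -> r'.-elt w' ->
    s.-nat #|w ^: G| -> s'.-nat #|w' ^: G| -> s <> s' -> s = r'.
  move=> s_pr s'_pr r'_pr Gw Gw' ntw ntw' r'w' sw s'w' /eqP neq_ss'.
  apply/eqP; apply: contraNT (nocent w w' Gw Gw' ntw ntw') => neq_sr'.
  apply: (coprime_class_cent (r := r')) => //.
    by rewrite (pi_pnat sw).
  by rewrite (pnat_coprime sw) // (pi_pnat s'w') // !inE eq_sym.
have elt_of r: prime r -> r %| #|G| ->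
    exists w, [/\ w \in A :|: B, w \in G, r.-elt w & w != 1].
  move=> r_pr r_dv; have := dvdn_cardMg A B; rewrite defG => /(dvdn_trans r_dv).
  rewrite Euclid_dvdM // => {}r_dv.
  have [w ABw ow]: exists2 w, w \in A :|: B & #[w] = r.
    by case/orP: r_dv => /(Cauchy r_pr)[w Xw ow]; exists w; rewrite // inE Xw ?orbT.
  exists w; split; rewrite ?sABG //; last by rewrite -order_gt1 ow prime_gt1.
  by rewrite /p_elt ow pnat_id.
have ntG: 1 < #|G|.
  by rewrite cardG_gt1; apply: contraNneq nsolG => ->; apply: solvable1.
have r_pr := pdiv_prime ntG; set r := pdiv _ in r_pr.
have [w [ABw Gw r_w ntw]] := elt_of r r_pr (pdiv_dvd _).
have [s [s_pr neq_sr sw]] := typeP r w r_pr ABw r_w ntw.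
(* Otherwise the class of [w] has size 1 and [w] centralises it, against [nocent]. *)
have s_dv_w: s %| #|w ^: G|.
  apply: contraLR (nocent w w Gw Gw ntw ntw); rewrite -p'natE // => s'w.
  have /eqP w1: #|w ^: G| == 1%N by rewrite -dvdn1 -(pnat_1 sw s'w).
  by rewrite negbK (coprime_class_cent (r := r)) ?w1.
have s_dv_G: s %| #|G|.
  by rewrite (dvdn_trans s_dv_w) // -index_cent1 dvdn_indexg.
have [v [ABv Gv s_v ntv]] := elt_of s s_pr s_dv_G.
have [s' [s'_pr neq_s's s'v]] := typeP s v s_pr ABv s_v ntv.
have eq_s'r: s' = r.
  by apply: (half s' r s v w) s'v sw _ => //; apply/eqP.
rewrite {s'}eq_s'r in s'_pr neq_s's s'v.
case/negP: nsolG; apply: Burnside_p_a_q_b; apply: (@uniq_leq_size _ _ [:: r; s]) => [|t].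
  exact: primes_uniq.
rewrite mem_primes !inE => /and3P[t_pr _ t_dv_G].
have [u [ABu Gu t_u ntu]] := elt_of t t_pr t_dv_G.
have [t' [t'_pr _ t'u]] := typeP t u t_pr ABu t_u ntu.
(* The class prime [t'] of [u] differs from [s] or from [r]; comparing [u] with [w] or [v]
   accordingly gives [t = s] or [t = r]. *)
have [eq_st' | /eqP neq_st'] := eqVneq s t'; last first.
  by rewrite (half s t t' w u _ _ _ _ _ _ _ _ sw t'u) ?eqxx ?orbT.
by rewrite (half r t t' v u _ _ _ _ _ _ _ _ s'v t'u) ?eqxx // -eq_st'; apply/eqP; rewrite eq_sym.
Qed.


(** * Elements of order prime to their class size *)

Lemma solvable_mem_pcore gT (G : {group gT}) (p q : nat) x :
    solvable G -> 'O_q(G) = 1 -> p != q -> x \in G -> p.-elt x ->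
  q.-nat #|x ^: G| -> x \in 'O_p(G).
Proof.
move=> solG Oq1 neq_pq Gx p_x qx.
have nilF := Fitting_nil G.
(* [x] centralises ['O_r(G)] for every prime [r != q], and ['O_q(G)] is trivial, so [x] centralises
   the Fitting subgroup. *)
have Fx: x \in 'F(G).
  rewrite (subsetP (solvable_cent_Fitting solG)) // inE Gx /= -sub_cent1 -{1}(Sylow_gen 'F(G)).
  rewrite gen_subG; apply/bigcupsP=> P /SylowP[r r_pr sylP].
  rewrite (nilpotent_Hall_pcore nilF sylP) (subset_trans (pcore_Fitting _ _)) //.
  have [-> | neq_rq] := eqVneq r q; first by rewrite Oq1 sub1G.
  by rewrite sub_cent1 cent_pcore_class // (pi_pnat qx) // !inE eq_sym.
rewrite (subsetP (pcore_Fitting p G)) //.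
by rewrite (mem_normal_Hall (nilpotent_pcore_Hall p nilF)) ?pcore_normal.
Qed.

Lemma Baer_class_pcore1 gT (G A B : {group gT}) (p q : nat) x :
    Baer_factorisation G A B -> 'O_q(G) = 1 -> prime q -> p != q -> x \in A ->
    p.-elt x -> q.-nat #|x ^: G| ->
  q.-nat #|A : 'C_A[x]|.
Proof.
move=> baerG Oq1 q_pr neq_pq Ax p_x qx; have [defG _] := baerG.
have sAG: A \subset G by rewrite -defG mulG_subl.
have Opx: x \in 'O_p(G).
  by apply: solvable_mem_pcore qx; rewrite ?(subsetP sAG) ?(Baer_solvable baerG).
apply: index_pnat_of_elts => [|r z r_pr neq_rq Az r_z]; first exact: subsetIl.
rewrite inE Az /=; have ABz: z \in A :|: B by rewrite inE Az.
have [s s_pr sz] := Baer_class baerG ABz r_pr r_z.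
(* If [s = q], then [z] centralises ['O_p(G)], which contains [x]; otherwise [x] and [z] have
   coprime class sizes. *)
have [eq_sq | neq_sq] := eqVneq s q.
  have /centP cOz: z \in 'C('O_p(G)).
    by rewrite cent_pcore_class // (pi_pnat sz) // eq_sq !inE eq_sym.
  by apply/cent1P; apply: cOz.
have: z \in 'C(x ^: G).
  apply: (coprime_class_cent (r := r)); rewrite ?(subsetP sAG) //.
    by rewrite (pi_pnat qx) // !inE eq_sym.
  by rewrite (pnat_coprime qx) // (pi_pnat sz).
by move/centP=> cxz; apply/cent1P/cxz/class_refl.
Qed.

(** Let [H] be the preimage in [A] of the centraliser of [coset N x]. The Frattini argument for the
    Sylow subgroup [<[x]>] of [H :&: N<[x]>] gives [H = (H :&: N) 'C_H[x]]. *)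
Lemma class_pnat_quotient gT (A N : {group gT}) (p q : nat) x :
    A \subset 'N(N) -> q.-group N -> p != q -> x \in A -> p.-elt x ->
    q.-nat #|A / N : 'C_(A / N)[coset N x]| ->
  q.-nat #|A : 'C_A[x]|.
Proof.
move=> nNA qN neq_pq Ax p_x qx.
have nNx := subsetP nNA x Ax.
pose H := (A :&: coset N @*^-1 'C[coset N x])%G.
have sHA: H \subset A by apply: subsetIl.
have Hx: x \in H by rewrite inE Ax mem_morphpre //; apply/cent1P.
have qH: q.-nat #|A : H|.
  rewrite -(@index_quotient_eq _ A N H) //; last first.
    rewrite subsetI subsetIl; apply/subsetP=> n /setIP[_ Nn].
    by rewrite mem_morphpre ?(subsetP (normG N)) //= coset_id //.
  apply: pnat_dvd qx; apply: indexgS; apply/subsetP=> _ /setIP[/morphimP[a nNa Aa ->] cax].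
  by apply: mem_quotient; rewrite inE Aa mem_morphpre.
pose W := (coset N @*^-1 <[coset N x]>)%G.
have coNx: coprime #|N| #|<[x]>|.
  by rewrite (pnat_coprime qN) // (pi_pnat p_x).
have defW: W :=: N * <[x]>.
  by rewrite /= -quotient_cycle // quotientK // cycle_subG.
pose U := (H :&: W)%G.
have nsUH: U <| H.
  apply: (@normalGI _ (coset N @*^-1 'C[coset N x])); first exact: subsetIr.
  rewrite cosetpre_normal /normal cycle_subG cent1id.
  by rewrite cents_norm // cent_cycle.
have sxU: <[x]> \subset U.
  have sxW: <[x]> \subset W by rewrite defW mulG_subr.
  by rewrite subsetI sxW andbT cycle_subG.
have sylx: p.-Sylow(U) <[x]>.
  have px: p.-nat #|<[x]>| := p_x.
  have partW: (#|W|`_p)%N = #|<[x]>|.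
    rewrite defW (TI_cardMg (coprime_TIg coNx)) partnM // part_p'nat ?mul1n ?part_pnat_id //.
    by rewrite (pi_pnat qN) // !inE eq_sym.
  rewrite pHallE sxU eqn_dvd -{1}(part_pnat_id px) partn_dvd ?cardSg //=.
  by rewrite -partW partn_dvd ?cardSg ?subsetIr.
(* The commutator of such an element with [x] lies in [N :&: <[x]>], which is trivial by
   coprimality. *)
have cNx: 'N_H(<[x]>) \subset 'C_H[x].
  apply/subsetP=> n /setIP[Hn nxn]; rewrite inE Hn /=.
  have [An nNn cxn] : [/\ n \in A, n \in 'N(N) & coset N n \in 'C[coset N x]].
    have [An /morphpreP[nNn cxn]] := setIP Hn; by [].
  rewrite cent1C; apply/cent1P/commgP; rewrite -in_set1 -[[set 1]](coprime_TIg coNx).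
  apply/setIP; split; last first.
    by rewrite commgEl groupM ?groupV ?memJ_norm ?cycle_id.
  rewrite coset_idr ?groupR // morphR //.
  by apply/eqP/commgP/cent1P; rewrite cent1C.
have defH: (H :&: N) * 'C_H[x] = H.
  apply/eqP; rewrite eqEsubset mul_subG ?subsetIl //=.
  apply/subsetP=> h; rewrite -{1}(Frattini_arg nsUH sylx) => /mulsgP[u n Uu Nn ->].
  have [Hu] := setIP Uu; rewrite /= -/W defW => /mulsgP[v c Nv xc defu].
  have Hc: c \in H by rewrite (subsetP _ c xc) ?cycle_subG.
  rewrite defu -mulgA mem_mulg //.
    by rewrite inE Nv -(mulgK c v) -defu groupM ?groupV.
  rewrite groupM ?(subsetP cNx) // inE Hc.
  by rewrite (subsetP _ c xc) // cycle_subG cent1id.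
have qC: q.-nat #|H : 'C_H[x]|.
  apply: (pnat_indexM (K := H :&: N)); last exact: pgroupS (subsetIr H N) qN.
  by rewrite -invMG defH invGid.
rewrite (pnat_dvd (indexgS A (setSI _ sHA))) //.
by rewrite -(Lagrange_index sHA (subsetIl H 'C[x])) pnatM qH.
Qed.

(** * Elements of [q]-power order with class size a power of [q] *)

Lemma Sylow_normal_class gT (G N : {group gT}) (q r : nat) x z :
    N <| G -> q.-Sylow(G) N -> prime q -> r != q -> q.-nat #|x ^: G| ->
    z \in G -> r.-elt z ->
  exists2 n, n \in N & x ^ n \in 'C[z].
Proof.
move=> nsNG sylN q_pr neq_rq qx Gz r_z.
have r'x: r^'.-nat #|x ^: G| by rewrite (pi_pnat qx) // !inE eq_sym.
have [g Gg cxz] := conj_cent1_elt r'x Gz r_z.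
have [n Nn defxg] := classJ_cent1M (Sylow_cent1M sylN qx) Gg.
by exists n; rewrite // -defxg cent1C.
Qed.

(** Each element of [P] lies in ['O_q(G)] or centralises it, depending on its class prime, and no
    group is the union of two proper subgroups. *)
Lemma Baer_pcore_cent gT (G A B P : {group gT}) (q : nat) :
    Baer_factorisation G A B -> prime q -> P \subset A -> q.-group P ->
  P \subset 'O_q(G) \/ P \subset 'C('O_q(G)).
Proof.
move=> baerG q_pr sPA qP; have [defG _] := baerG.
have cover y: y \in P -> y \in 'O_q(G) \/ y \in 'C('O_q(G)).
  move=> Py; have Ay := subsetP sPA y Py; have q_y := mem_p_elt qP Py.
  have Gy: y \in G by rewrite (subsetP _ y Ay) // -defG mulG_subl.
  have ABy: y \in A :|: B by rewrite inE Ay.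
  have [s s_pr sy] := Baer_class baerG ABy q_pr q_y.
  have [eq_sq | neq_sq] := eqVneq s q; [left | right].
    by apply: mem_pcore_class; rewrite // -eq_sq.
  by apply: cent_pcore_class; rewrite (pi_pnat sy).
have [sPO | /subsetPn[a Pa O'a]] := boolP (P \subset 'O_q(G)); first by left.
right; apply/subsetP=> b Pb; have [Ob | //] := cover b Pb.
have [/(negP O'a) | Ca] := cover a Pa; first by [].
have [Oab | Cab] := cover (a * b) (groupM Pa Pb); last by rewrite groupMl in Cab.
by case/negP: O'a; rewrite groupMr in Oab.
Qed.

Lemma Baer_class_pcore_Sylow gT (G A B : {group gT}) (q : nat) x :
    Baer_factorisation G A B -> prime q -> q.-Sylow(G) 'O_q(G) ->
    x \in A -> q.-elt x -> q.-nat #|x ^: G| ->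
  q.-nat #|A : 'C_A[x]|.
Proof.
move=> baerG q_pr sylN Ax q_x qx; have [defG _] := baerG.
have sAG: A \subset G by rewrite -defG mulG_subl.
pose N := 'O_q(G)%G; rewrite -/(gval N) in sylN.
have nsNG: N <| G := pcore_normal q G; have qN: q.-group N := pcore_pgroup q G.
have [P [Q [S [sylP sylQ sylS defS]]]] := Sylow_mulG q defG.
have eqSN: S :=: N.
  by apply/eqP; rewrite eq_sym eqEcard pcore_sub_Hall //= (card_Hall sylS) (card_Hall sylN).
apply: index_pnat_of_elts => [|r z r_pr neq_rq Az r_z]; first exact: subsetIl.
rewrite inE Az cent1C /=; have Gz := subsetP sAG z Az.
pose C := 'C_N[z]%G.
have sZC: 'Z(N) \subset 'C(C) by rewrite subIset // centS ?orbT ?subsetIl.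
have defN: C * 'Z(N) = N.
  rewrite -cent_joinEr //.
  have sDN: (C <*> 'Z(N))%G \subset N by rewrite join_subG !subsetIl.
  (* Such an [M] is normal in [N] and would contain every element of [A] or [B] lying in [N], hence
     [P], [Q] and their product [N]. *)
  have [// | [M maxM]] := maximal_exists sDN; rewrite join_subG => /andP[sCM sZM].
  have /andP[sMN nMN] := p_maximal_normal qN maxM.
  have inM y: y \in A :|: B -> y \in N -> y \in M.
    move=> ABy Ny; have q_y := mem_p_elt qN Ny.
    have [s s_pr sy] := Baer_class baerG ABy q_pr q_y.
    have [eq_sq | neq_sq] := eqVneq s q.
      rewrite eq_sq in sy.
      have [n Nn cyn] := Sylow_normal_class nsNG sylN q_pr neq_rq sy Gz r_z.
      by rewrite -(memJ_norm y (subsetP nMN n Nn)) (subsetP sCM) // inE groupJ.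
    rewrite (subsetP sZM) // inE Ny /=.
    by apply: cent_pcore_class; rewrite (pi_pnat sy).
  have /andP[_ /negP[]] : M \proper N := maxgroupp maxM.
  rewrite -eqSN -defS mul_subG //; apply/subsetP=> y Xy; apply: inM.
  - by rewrite inE (subsetP (pHall_sub sylP)).
  - by rewrite -eqSN -defS -[y]mulg1 mem_mulg.
  - by rewrite inE (subsetP (pHall_sub sylQ)) ?orbT.
  by rewrite -eqSN -defS -[y]mul1g mem_mulg.
have Nx: x \in N by rewrite mem_pcore_class ?(subsetP sAG).
have [n Nn cxn] := Sylow_normal_class nsNG sylN q_pr neq_rq qx Gz r_z.
(* Write [n^-1 = c * t] with [c] in [C] and [t] in ['Z(N)]: then [x] is [(x ^ n) ^ c], a conjugate
   inside [C]. *)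
have: n^-1 \in N by rewrite groupV.
rewrite -{1}defN => /mulsgP[c t Cc /setIP[_ /centP cNt] defn].
have Cxnc: (x ^ n) ^ c \in C by rewrite groupJ // inE groupJ.
have [Nxnc cxnc] := setIP Cxnc.
rewrite -(conjgK n x) defn conjgM.
have /commgP/conjg_fixP-> // : commute ((x ^ n) ^ c) t.
exact/commute_sym/cNt.
Qed.

Lemma Baer_class_pcore gT (G A B : {group gT}) (q : nat) x :
    Baer_factorisation G A B -> prime q -> x \in A -> q.-elt x ->
    q.-nat #|x ^: G| ->
  q.-nat #|A : 'C_A[x]|.
Proof.
move=> baerG q_pr Ax q_x qx; have [defG _] := baerG.
have sAG: A \subset G by rewrite -defG mulG_subl.
have Nx: x \in 'O_q(G) by rewrite mem_pcore_class ?(subsetP sAG).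
have [P [Q [S [sylP sylQ sylS defS]]]] := Sylow_mulG q defG.
have [sPA qP _] := and3P sylP; have [sQB qQ _] := and3P sylQ.
have Px: x \in P.
  rewrite (subsetP (pcore_sub_Hall sylP)) // (subsetP (pcoreS q sAG)) //.
  by rewrite inE Ax.
(* [G = C_G(x) S = C_G(x) Q P = C_G(x) P], hence [A = C_A(x) P]. *)
have doneQ: Q \subset 'C[x] -> q.-nat #|A : 'C_A[x]|.
  move=> cQx; apply: (pnat_indexM (K := P)) => //.
  have sQC: Q \subset 'C_G[x].
    by rewrite subsetI cQx (subset_trans sQB) // -defG mulG_subr.
  have defCA: 'C_A[x] = A :&: 'C_G[x] by rewrite setIA (setIidPl sAG).
  rewrite /= defCA group_modr //.
  by rewrite -{1}(mulGSid sQC) -mulgA -invMG defS invGid (Sylow_cent1M sylS qx) (setIidPl sAG).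
(* [Q] centralises [x] if it centralises ['O_q(G)], or if it lies there and [P] centralises
   ['O_q(G)]. Otherwise [P] and [Q] lie in ['O_q(G)], which is then Sylow. *)
have [sQN | cQN] := Baer_pcore_cent (Baer_factorisationC baerG) q_pr sQB qQ; last first.
  by apply: doneQ; rewrite (subset_trans cQN) // -cent_set1 centS ?sub1set.
have [sPN | cPN] := Baer_pcore_cent baerG q_pr sPA qP; last first.
  by apply: doneQ; rewrite -cent_set1 centsC sub1set (subsetP (centS sQN)) // (subsetP cPN).
apply: (Baer_class_pcore_Sylow baerG) qx => //.
have defO: S :=: 'O_q(G).
  by apply/eqP; rewrite eqEsubset pcore_sub_Hall // -defS mul_subG.
by rewrite pHallE pcore_sub /= -defO (card_Hall sylS).
Qed.

(** For [p != q], passing to [G / 'O_q(G)] makes the [q]-core trivial, and [class_pnat_quotient]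
    brings the result back to [A]. *)
Lemma Baer_class_sub gT (G A B : {group gT}) (p q : nat) x :
    Baer_factorisation G A B -> prime q -> x \in A -> p.-elt x ->
    q.-nat #|x ^: G| ->
  q.-nat #|A : 'C_A[x]|.
Proof.
move=> baerG q_pr Ax p_x qx; have [defG _] := baerG.
have [eq_pq | neq_pq] := eqVneq p q.
  by rewrite eq_pq in p_x; apply: (Baer_class_pcore baerG) qx.
have nsNG := pcore_normal q G; have nNG := normal_norm nsNG.
have nNA: A \subset 'N('O_q(G)) by rewrite (subset_trans _ nNG) // -defG mulG_subl.
apply: (class_pnat_quotient nNA (pcore_pgroup q G) neq_pq Ax p_x).
apply: (Baer_class_pcore1 (Baer_quotient nsNG baerG) _ q_pr neq_pq).
- exact: trivg_pcore_quotient.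
- exact: mem_quotient.
- exact: morph_p_elt (subsetP nNA x Ax) p_x.
exact: pnat_dvd (dvdn_class_quotient x nsNG) qx.
Qed.

End BaerFactorisations.

Theorem proposition4 (gT : finGroupType) (G A B : {group gT})
    (hBaer : Baer_factorisation G A B) :
  (forall (X : {group gT}) (x : gT) (q : nat),
      X = A \/ X = B -> x \in X -> prime_power #[x] -> prime q ->
      q.-nat (elt_index G x) -> q.-nat (elt_index X x)) /\
  (Baer_group A /\ Baer_group B).
Proof.
have sub (X : {group gT}) x q : X = A \/ X = B -> x \in X -> prime_power #[x] ->
    prime q -> q.-nat (elt_index G x) -> q.-nat (elt_index X x).
  rewrite /elt_index index_cent1 => defX Xx [p _ p_x] q_pr qx.
  case: defX Xx => -> Xx; first exact: Baer_class_sub hBaer q_pr Xx p_x qx.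
  exact: Baer_class_sub (Baer_factorisationC hBaer) q_pr Xx p_x qx.
have [_ baerG] := hBaer; split=> //.
split=> x Xx ppx.
  have [|q q_pr qx] := baerG x _ ppx; first by rewrite inE Xx.
  by exists q => //; apply: sub qx => //; left.
have [|q q_pr qx] := baerG x _ ppx; first by rewrite inE Xx orbT.
by exists q => //; apply: sub qx => //; right.
Qed.
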